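(* Let $p(\cdot):\mathbb{N}\to[1,\infty)$ be an exponent function. Then $\mathcal{Z}_{p(\cdot)}$ is dense in $\ell^{p(\cdot)}$.
   Context: Sequences are real. $\ell^{p(\cdot)}$ is the space of sequences $x$ with $\sum_{k}|x(k)/\lambda|^{p(k)}<\infty$ for some $\lambda>0$, normed by $\|x\|_{\ell^{p(\cdot)}}=\inf\{\lambda>0:\sum_{k}|x(k)/\lambda|^{p(k)}\le1\}$; $\operatorname{supp}(x)=\{k:x(k)\ne0\}$. A set $A\subseteq\mathbb{N}$ has finite $p(\cdot)$-content if there is $B>1$ with $\sum_{k\in A}B^{-p(k)}<\infty$; $\mathcal{M}_{p(\cdot)}$ is the collection of all such sets. $S_{p(\cdot)}$ is the set of all finite sums $\sum_{k=1}^N\alpha_k\mathbf 1_{A_k}$ with $\alpha_k\in\mathbb{R}$ and $A_k\in\mathcal{M}_{p(\cdot)}$ pairwise disjoint. For $m\in\mathbb{Z}$, $S^m_{p(\cdot)}$ is the set of $x\in S_{p(\cdot)}$ such that $|x(k)|\in(2^{m-1},2^m]\cup\{0\}$ for every $k$. $\mathcal{Z}_{p(\cdot)}$ is the set of all $x\in\ell^{p(\cdot)}$ such that, for some $M\in\mathbb{Z}$, there is a sequence $\{y_m\}_{m=-\infty}^M$ with $y_m\in S^m_{p(\cdot)}$, $\operatorname{supp}(y_m)\cap\operatorname{supp}(y_n)=\emptyset$ for $m\ne n$, and $x=\sum_{m=-\infty}^M y_m$, the sum being understood pointwise (coordinatewise; convergence in norm is not required). *)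

(* Defs.v *)
From HB Require Import structures.
From mathcomp Require Import all_boot all_order all_algebra.
From mathcomp Require Import all_classical all_reals all_analysis.

Set Implicit Arguments.
Unset Strict Implicit.
Unset Printing Implicit Defensive.

Import Order.TTheory GRing.Theory Num.Theory.
Import numFieldNormedType.Exports.

Local Open Scope classical_set_scope.
Local Open Scope ring_scope.

Definition lp_modular (R : realType) (p x : R^nat) : \bar R :=
  (\sum_(0 <= k <oo) (`|x k| `^ p k)%R%:E)%E.

Definition lp_space (R : realType) (p : R^nat) : set R^nat :=
  [set x | exists2 lambda : R, 0 < lambda &
     (lp_modular p (fun k => x k / lambda)%R < +oo)%E].

(* The infimum is over a nonempty set as soon as [x] belongs to [lp_space p]; outside
   of [lp_space p], [inf set0 = 0] is a junk value. *)
Definition lp_norm (R : realType) (p x : R^nat) : R :=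
  inf [set lambda : R | 0 < lambda /\
     (lp_modular p (fun k => x k / lambda)%R <= 1)%E].

Definition seq_support (R : realType) (x : R^nat) : set nat := [set k | x k != 0].

Definition finite_content (R : realType) (p : R^nat) : set (set nat) :=
  [set A | exists2 B : R, 1 < B &
     (\esum_(k in A) (B `^ (- p k))%R%:E < +oo)%E].

Definition simple_seq (R : realType) (p : R^nat) : set R^nat :=
  [set x | exists (N : nat) (alpha : 'I_N -> R) (A : 'I_N -> set nat),
     [/\ forall i, finite_content p (A i),
         trivIset setT A &
         forall k, x k = \sum_(i < N) alpha i * \1_(A i) k]].

Definition simple_level (R : realType) (p : R^nat) (m : int) : set R^nat :=
  [set x | simple_seq p x /\
     forall k, x k = 0 \/ 2 ^ (m - 1) < `|x k| <= 2 ^ m].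

(* Only the values [y m] with [m <= M] matter.  The coordinatewise sum over
   m = M, M - 1, M - 2, ... is the limit of its partial sums. *)
Definition Zspace (R : realType) (p : R^nat) : set R^nat :=
  [set x | lp_space p x /\
     exists (M : int) (y : int -> R^nat),
       [/\ forall m, m <= M -> simple_level p m (y m),
           forall m n, m <= M -> n <= M -> m != n ->
             seq_support (y m) `&` seq_support (y n) = set0 &
           forall k,
             series (fun j : nat => y (M - j%:Z) k) @ \oo --> x k]].

Definition lp_dense (R : realType) (p : R^nat) (D : set R^nat) : Prop :=
  D `<=` lp_space p /\
  forall x, lp_space p x -> forall eps : R, 0 < eps ->
    exists2 z, D z & lp_norm p (x \- z) < eps.

(* Main.v *)
(** Given [x] in the space, round each [|x k|] in [(2^(m-1), 2^m]] up to a multiple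
    of [2^m / J], keeping the sign.  The result has finitely many values on
    each dyadic level, and the error is at most [2 |x k| / J], so its norm is at most
    [2 / J] times that of [x].  The levels have finite content by Chebyshev's inequality,
    and there is a largest one because [x] is bounded. *)
Require Import Defs.
From mathcomp Require Import all_boot all_order all_algebra.
From mathcomp Require Import all_classical all_reals all_analysis.
From mathcomp Require Import lra ring.

Set Implicit Arguments.
Unset Strict Implicit.
Unset Printing Implicit Defensive.

Import Order.TTheory GRing.Theory Num.Theory.
Import numFieldNormedType.Exports.

Local Open Scope classical_set_scope.
Local Open Scope ring_scope.

(** * Comparison and boundedness for the modular *)

Lemma normr_divp (R : numFieldType) (a b : R) : 0 < b -> `|a / b| = `|a| / b.
Proof. by move=> b0; rewrite normrM normfV (gtr0_norm b0). Qed.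

(** For [q >= 1] and [0 <= c <= 1] one has [c ^ q <= c]. The factor [c] does not depend on [q], so
    the bound is uniform even over unbounded exponents. *)
Lemma powR_leM (R : realType) (q c a b : R) : 1 <= q -> 0 <= c <= 1 ->
  0 <= a <= c * b -> 0 <= b -> a `^ q <= c * b `^ q.
Proof.
move=> q1 /andP[c0 c1] /andP[a0 ab] b0.
have q0 : 0 <= q by lra.
apply: (@le_trans _ _ ((c * b) `^ q)).
  by apply: ge0_ler_powR; rewrite ?nnegrE ?mulr_ge0.
move: c0; rewrite le_eqVlt => /predU1P[<-|c0].
  by rewrite !mul0r powR0 //; lra.
by apply: ge1r_powRZ; rewrite ?c0.
Qed.

Lemma lp_modular_leM (R : realType) (p u v : R^nat) (c : R) :
  (forall k, 1 <= p k) -> 0 <= c <= 1 -> (forall k, `|u k| <= c * `|v k|) ->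
  (lp_modular p u <= c%:E * lp_modular p v)%E.
Proof.
move=> p1 c01 uv.
rewrite /lp_modular -nneseriesZl; last by move=> k _; rewrite lee_fin powR_ge0.
apply: lee_nneseries => [k _ _|k _]; first by rewrite lee_fin powR_ge0.
by rewrite -EFinM lee_fin powR_leM ?normr_ge0 ?uv.
Qed.

(** Each term is at most the whole sum, and [|u k| <= |u k| ^ p k] once [|u k| >= 1], because
    [p k >= 1]. *)
Lemma lp_modular_bounded (R : realType) (p u : R^nat) :
  (forall k, 1 <= p k) -> (lp_modular p u < +oo)%E ->
  exists2 C : R, 1 <= C & forall k, `|u k| <= C.
Proof.
move=> p1 fin_u.
have term_le k : ((`|u k| `^ p k)%:E <= lp_modular p u)%E.
  apply: le_trans (nneseries_lim_ge k.+1 _); last first.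
    by move=> n _ _; rewrite lee_fin powR_ge0.
  rewrite big_mkord big_ord_recr /= leeDr //.
  by apply: sume_ge0 => i _; rewrite lee_fin powR_ge0.
have mod_ge0 : (0 <= lp_modular p u)%E.
  by apply: le_trans (term_le 0%N); rewrite lee_fin powR_ge0.
have fin : lp_modular p u \is a fin_num by rewrite ge0_fin_numE.
have C0 := fine_ge0 mod_ge0.
exists (1 + fine (lp_modular p u)) => [|k]; first lra.
have [u1|/ltW u1] := leP `|u k| 1; first lra.
have := term_le k; rewrite -(fineK fin) lee_fin.
have := le1r_powR u1 (p1 k); lra.
Qed.

(** * Sets of finite content and simple sequences *)

Lemma finite_content_subset (R : realType) (p : R^nat) (A B : set nat) :
  A `<=` B -> finite_content p B -> finite_content p A.
Proof.
move=> AB [b b1 fin_b]; exists b => //; apply: le_lt_trans fin_b.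
rewrite (esum_mkcond A) (esum_mkcond B); apply: le_esum => k _.
have [kA|_] := boolP (k \in A).
  by rewrite ifT //; move: kA; rewrite !inE; apply: AB.
by case: ifP => // _; rewrite lee_fin powR_ge0.
Qed.

(** Chebyshev: if [a < |x k|] and [B >= l / a], then [B * |x k / l| >= 1], so
    [B ^ (- p k) <= |x k / l| ^ p k], which is summable. *)
Lemma finite_content_gt (R : realType) (p x : R^nat) (a : R) :
  (forall k, 1 <= p k) -> lp_space p x -> 0 < a ->
  finite_content p [set k | a < `|x k|].
Proof.
move=> p1 [l l0 fin_x] a0.
(* The maximum with 2 keeps the base above 1 even when [l / a <= 1]. *)
have ge2 : (2 : R) <= Num.max 2 (l / a) by rewrite le_max lexx.
exists (Num.max 2 (l / a)); first lra.
apply: le_lt_trans fin_x.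
rewrite /lp_modular nneseries_esumT; last by move=> k; rewrite lee_fin powR_ge0.
rewrite esum_mkcond; apply: le_esum => k _.
case: ifP => [|_]; last by rewrite lee_fin powR_ge0.
rewrite inE /= => ak; rewrite lee_fin powRN.
have pk0 : 0 <= p k by have := p1 k; lra.
rewrite -[leLHS]div1r ler_pdivrMr ?powR_gt0 //; last lra.
rewrite -powRM //; last lra.
have ge1 : 1 <= `|x k / l| * Num.max 2 (l / a).
  apply: (@le_trans _ _ (`|x k / l| * (l / a))); last first.
    by rewrite ler_wpM2l // le_max lexx orbT.
  rewrite normr_divp // mulrA divfK ?gt_eqF //.
  by rewrite ler_pdivlMr // mul1r ltW.
have := @ge0_ler_powR _ _ pk0 1 _ _ _ ge1; rewrite powR1; apply; rewrite nnegrE; lra.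
Qed.

(** The level sets of the nonzero values partition the support; removing duplicates from [s] makes
    them disjoint. As [s] may contain 0, they are cut with [y k != 0]: the zero set may have
    infinite content. *)
Lemma simple_seq_finite_range (R : realType) (p y : R^nat) (s : seq R) :
  (forall k, y k != 0 -> y k \in s) -> finite_content p (seq_support y) ->
  simple_seq p y.
Proof.
move=> ys fin_y; set t := undup s.
exists (size t), (fun i => nth 0 t i), (fun i => [set k | y k != 0 /\ y k = nth 0 t i]).
split=> [i||k].
- by apply: finite_content_subset fin_y => k [].
- apply/trivIsetP => i j _ _ ij; rewrite -subset0 => k [[_ yki] [_ ykj]].
  have : nth 0 t i == nth 0 t j by rewrite -yki -ykj.
  by rewrite nth_uniq ?undup_uniq // => /eqP/val_inj/eqP; rewrite (negPf ij).
- have [y0|y0] := eqVneq (y k) 0.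
    rewrite y0 big1 // => i _; rewrite indicE memNset ?mulr0 //.
    by move=> [/=]; rewrite y0 eqxx.
  have kt : y k \in t by rewrite mem_undup ys.
  have it : (index (y k) t < size t)%N by rewrite index_mem.
  rewrite (bigD1 (Ordinal it)) //= big1 ?addr0 => [|i neq].
    by rewrite indicE mem_set ?mulr1 /= ?nth_index.
  rewrite indicE memNset ?mulr0 // => -[_ /= yk].
  by case/eqP: neq; apply: val_inj; rewrite /= yk index_uniq ?undup_uniq.
Qed.

(** * Dyadic levels and rounding within a level *)

Definition dyadic_level (R : realType) (a : R) : int := Num.ceil (ln a / ln 2).

Lemma dyadic_levelP (R : realType) (a : R) : 0 < a ->
  2 ^ (dyadic_level a - 1) < a <= 2 ^ dyadic_level a.
Proof.
move=> a0; have ln2 : 0 < ln (2 : R) by rewrite ln_gt0 // ltr1n.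
have ln2X (n : int) : ln ((2 : R) ^ n) = n%:~R * ln 2.
  by rewrite -powR_intmul // ln_powR.
rewrite -ltr_ln ?posrE ?exprz_gt0 // -ler_ln ?posrE ?exprz_gt0 // !ln2X.
by rewrite -ltr_pdivlMr // -ler_pdivrMr // ceil_itv.
Qed.

Lemma le_dyadic_level (R : realType) (a b : R) : 0 < a -> a <= b ->
  dyadic_level a <= dyadic_level b.
Proof.
move=> a0 ab; apply: le_ceil; rewrite ler_pM2r ?invr_gt0 ?ln_gt0 ?ltr1n //.
by rewrite ler_ln ?posrE //; lra.
Qed.

(** Rounding up, not down, keeps the value above the open endpoint [2 ^ (m - 1)]; the closed
    endpoint [2 ^ m] is itself a grid point, so the value stays in its level. *)
Definition dyadic_round (R : realType) (J : nat) (a : R) : R :=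
  2 ^ dyadic_level a * (Num.ceil (J%:R * (a / 2 ^ dyadic_level a)))%:~R / J%:R.

Section DyadicRound.
Context (R : realType) (J : nat) (a : R).
Hypotheses (J0 : (0 < J)%N) (a0 : 0 < a).

Lemma dyadic_round_ge : a <= dyadic_round J a.
Proof.
have J0' : 0 < J%:R :> R by rewrite ltr0n.
have w0 : 0 < (2 : R) ^ dyadic_level a by rewrite exprz_gt0.
rewrite /dyadic_round -mulrA -ler_pdivrMl // ler_pdivlMr // mulrC [_^-1 * a]mulrC.
exact: ceil_ge.
Qed.

(** Since [a / 2 ^ m] lies in [[0, 1]], the ceiling lies between 0 and [J]; the resulting list
    depends on [a] only through its level. *)
Lemma dyadic_round_mem :
  dyadic_round J a \in [seq 2 ^ dyadic_level a * i%:R / J%:R | i <- iota 0 J.+1].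
Proof.
have J0' : 0 < J%:R :> R by rewrite ltr0n.
have w0 : 0 < (2 : R) ^ dyadic_level a by rewrite exprz_gt0.
have t0 : 0 <= J%:R * (a / 2 ^ dyadic_level a) by rewrite mulr_ge0 ?divr_ge0 // ltW.
have tJ : Num.ceil (J%:R * (a / 2 ^ dyadic_level a)) <= J%:Z.
  rewrite ceil_le_int ger_pMr // ler_pdivrMr // mul1r.
  by have /andP[] := dyadic_levelP a0.
have : 0 <= Num.ceil (J%:R * (a / 2 ^ dyadic_level a)).
  by rewrite ceil_ge0 (lt_le_trans _ t0) // ltrN10.
rewrite /dyadic_round; move: tJ.
case: (Num.ceil _) => // n; rewrite lez_nat => nJ _.
by apply/mapP; exists n; rewrite // mem_iota.
Qed.

Lemma dyadic_round_le : dyadic_round J a <= 2 ^ dyadic_level a.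
Proof.
have J0' : 0 < J%:R :> R by rewrite ltr0n.
case/mapP: dyadic_round_mem => i; rewrite mem_iota /= add0n ltnS => iJ ->.
by rewrite ler_pdivrMr // ler_pM2l ?exprz_gt0 // ler_nat.
Qed.

(** The error is below one grid step [2 ^ m / J], and [2 ^ m < 2 * a] because [a] exceeds
    [2 ^ (m - 1)]. *)
Lemma dyadic_round_err : dyadic_round J a - a <= 2 / J%:R * a.
Proof.
have J0' : 0 < J%:R :> R by rewrite ltr0n.
have w0 : 0 < (2 : R) ^ dyadic_level a by rewrite exprz_gt0.
have /andP[wa _] := dyadic_levelP a0.
have {}wa : 2 ^ dyadic_level a <= 2 * a.
  by move: wa; rewrite expfzDr // exprN1 ltr_pdivrMr // mulrC => /ltW.
rewrite /dyadic_round.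
have /andP[] := ceil_itv (J%:R * (a / 2 ^ dyadic_level a)).
set n := Num.ceil _; move: n wa w0 => n.
set w := (2 : R) ^ _; move: w => w wa w0.
rewrite rmorphB /= => nt _.
rewrite -(ler_pM2r J0') mulrBl divfK ?gt_eqF //.
have -> : 2 / J%:R * a * J%:R = 2 * a by field; rewrite gt_eqF.
have : w * (n%:~R - 1) < w * (J%:R * (a / w)) by rewrite ltr_pM2l.
have -> : w * (J%:R * (a / w)) = a * J%:R by field; rewrite gt_eqF.
lra.
Qed.

End DyadicRound.

(** * The rounded sequence and its decomposition into levels *)

Section DyadicApproximation.
Context (R : realType) (p x : R^nat) (J : nat).
Hypotheses (p1 : forall k, 1 <= p k) (J0 : (0 < J)%N) (lpx : lp_space p x).

Definition dyadic_approx : R^nat := fun k => Num.sg (x k) * dyadic_round J `|x k|.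

(** The cut is by the level of [x]; at nonzero coordinates rounding preserves the level, so it is
    also the level of the approximant. *)
Definition dyadic_piece (m : int) : R^nat :=
  fun k => if dyadic_level `|x k| == m then dyadic_approx k else 0.

(* Here [dyadic_level 0] is a junk value, made harmless by [Num.sg 0 = 0]. *)
Lemma dyadic_approx0 k : x k = 0 -> dyadic_approx k = 0.
Proof. by move=> xk; rewrite /dyadic_approx xk sgr0 mul0r. Qed.

Lemma norm_dyadic_approx k : x k != 0 ->
  `|dyadic_approx k| = dyadic_round J `|x k|.
Proof.
rewrite -normr_gt0 => x0; rewrite /dyadic_approx normrM normr_sg -normr_gt0 x0 mul1r.
by rewrite ger0_norm // (le_trans (ltW x0)) // dyadic_round_ge.
Qed.

Lemma dyadic_approx_err k : `|x k - dyadic_approx k| <= 2 / J%:R * `|x k|.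
Proof.
have [xk|xk] := eqVneq (x k) 0.
  by rewrite dyadic_approx0 // xk subr0 normr0 mulr0.
have x0 : 0 < `|x k| by rewrite normr_gt0.
rewrite [X in X - _]numEsg -mulrBr normrM normr_sg xk mul1r distrC.
by rewrite ger0_norm ?dyadic_round_err // subr_ge0 dyadic_round_ge.
Qed.

Lemma simple_level_dyadic_piece m : simple_level p m (dyadic_piece m).
Proof.
have range k : dyadic_piece m k = 0 \/ 2 ^ (m - 1) < `|dyadic_piece m k| <= 2 ^ m.
  rewrite /dyadic_piece; case: eqP => [<-|_]; last by left.
  have [xk|xk] := eqVneq (x k) 0; first by left; rewrite dyadic_approx0.
  right; have x0 : 0 < `|x k| by rewrite normr_gt0.
  rewrite norm_dyadic_approx // dyadic_round_le // andbT.
  have /andP[lt_x _] := dyadic_levelP x0.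
  exact: (lt_le_trans lt_x (dyadic_round_ge _ J0)).
split=> //.
(* The possible magnitudes on level [m]; their opposites are appended to allow for signs. *)
pose v := [seq 2 ^ m * i%:R / J%:R | i <- iota 0 J.+1] : seq R.
apply: (@simple_seq_finite_range _ _ _ (v ++ map -%R v)).
  move=> k; rewrite /dyadic_piece; case: (_ =P m) => [lvl|_]; last by rewrite eqxx.
  have [xk|xk _] := eqVneq (x k) 0; first by rewrite dyadic_approx0 // eqxx.
  have x0 : 0 < `|x k| by rewrite normr_gt0.
  have := dyadic_round_mem J0 x0; rewrite lvl -/v mem_cat /dyadic_approx.
  move: (dyadic_round J _) => r vr.
  case: sgrP xk => // [_ _|_ _]; first by rewrite mul1r vr.
  by rewrite mulN1r map_f ?orbT.
(* The support lies in the set where [|x k|] exceeds [2 ^ (m - 1)], which has finite content. *)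
have w0 : 0 < (2 : R) ^ (m - 1) by rewrite exprz_gt0.
apply: finite_content_subset (finite_content_gt p1 lpx w0) => k.
rewrite /seq_support /dyadic_piece /=; case: (_ =P m) => [<-|_]; last by rewrite eqxx.
have [xk|xk _] := eqVneq (x k) 0; first by rewrite dyadic_approx0 // eqxx.
have x0 : 0 < `|x k| by rewrite normr_gt0.
by have /andP[] := dyadic_levelP x0.
Qed.

Lemma lp_space_dyadic_approx : lp_space p dyadic_approx.
Proof.
(* The factor 3 bounds [1 + 2 / J], as [J >= 1]. *)
have [l l0 fin_x] := lpx; exists (3 * l); first by rewrite mulr_gt0.
have c01 : 0 <= (1 : R) <= 1 by rewrite ler01 lexx.
apply: le_lt_trans fin_x; rewrite -[leRHS]mul1e.
apply: lp_modular_leM => // k.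
have J1 : 1 <= J%:R :> R by rewrite ler1n.
have : 2 / J%:R * `|x k| <= 2 * `|x k|.
  by rewrite ler_wpM2r // ler_pdivrMr ?ltr0n // ler_peMr.
move=> le2; have le3 : `|dyadic_approx k| <= 3 * `|x k|.
  have := dyadic_approx_err k; have := ler_distD (x k) (dyadic_approx k) 0.
  by rewrite !subr0 distrC; lra.
rewrite mul1r !normr_divp ?mulr_gt0 //.
rewrite ler_pdivrMr ?mulr_gt0 //.
by have -> : `|x k| / l * (3 * l) = 3 * `|x k| by field; rewrite gt_eqF.
Qed.

Lemma Zspace_dyadic_approx : Zspace p dyadic_approx.
Proof.
split; first exact: lp_space_dyadic_approx.
have [l l0 fin_x] := lpx.
have [C C1 xC] := lp_modular_bounded p1 fin_x.
(* The bound [|x k| <= C * l] makes this the top level. *)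
exists (dyadic_level (C * l)), dyadic_piece; split=> [m _|m n _ _ mn|k].
- exact: simple_level_dyadic_piece.
- rewrite -subset0 => k [] /=; rewrite /seq_support /dyadic_piece /=.
  case: (_ =P m) => [->|_]; last by rewrite eqxx.
  by rewrite (negPf mn) eqxx.
- have [xk|xk] := eqVneq (x k) 0.
    rewrite dyadic_approx0 //; apply: cvg_near_cst; near=> n.
    rewrite /series /= big1 // => i _.
    by rewrite /dyadic_piece dyadic_approx0 // if_same.
  have lvl : dyadic_level `|x k| <= dyadic_level (C * l).
    apply: le_dyadic_level; first by rewrite normr_gt0.
    by have := xC k; rewrite normr_divp // ler_pdivrMr.
  (* At this coordinate only the piece of index [j0] is nonzero, so the partial sums are constant
     beyond [j0]. *)
  pose j0 := absz (dyadic_level (C * l) - dyadic_level `|x k|).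
  have j0E : (j0%:Z = dyadic_level (C * l) - dyadic_level `|x k|)%R.
    by rewrite gez0_abs // subr_ge0.
  apply: cvg_near_cst; near=> n.
  have j0n : (j0 < n)%N by near: n; exact: nbhs_infty_gt.
  rewrite /series /= big_mkord (bigD1 (Ordinal j0n)) //= big1 ?addr0.
    by rewrite /dyadic_piece j0E subKr eqxx.
  move=> i neq; rewrite /dyadic_piece; case: eqP => // lvl_i.
  case/eqP: neq; apply: val_inj => /=; apply/eqP.
  by rewrite -eqz_nat j0E lvl_i subKr.
Unshelve. all: by end_near. Qed.

End DyadicApproximation.

(** * Density *)

Theorem proposition4p7 (R : realType) (p : R^nat)
  (p_ge1 : forall k : nat, 1 <= p k) :
  lp_dense p (Zspace p).
Proof.
split=> [x []//|x lpx eps eps0].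
have [l l0 fin_x] := lpx.
have mod_ge0 : (0 <= lp_modular p (fun k => x k / l)%R)%E.
  by apply: nneseries_ge0 => k _ _; rewrite lee_fin powR_ge0.
have fin : lp_modular p (fun k => x k / l)%R \is a fin_num by rewrite ge0_fin_numE.
have C0 := fine_ge0 mod_ge0.
(* [C] may exceed 1, so [x / l] need not lie in the unit ball; the factor [(C + 1)^-1], which is at
   most 1, brings the modular down to [C / (C + 1) <= 1]. *)
set C := fine _ in C0.
(* This [J] gives [2 / J <= (C + 1)^-1 * (eps / 2) / l], the coordinatewise bound needed below. *)
pose J := (Num.truncn (4 * l * (C + 1) / eps)).+1.
have JE : 4 * l * (C + 1) / eps < J%:R by exact: truncnS_gt.
have J0 : 0 < J%:R :> R by rewrite ltr0n.
exists (dyadic_approx x J); first exact: Zspace_dyadic_approx.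
have C1 : 0 < C + 1 by lra.
(* An admissible scale bounds the infimum only weakly; testing [eps / 2] makes the final inequality
   strict. *)
apply: (@le_lt_trans _ _ (eps / 2)); last lra.
apply: ge_inf; first by exists 0 => r [/ltW].
split; first by rewrite divr_gt0.
apply: (@le_trans _ _ ((C + 1)^-1%:E * lp_modular p (fun k => x k / l)%R)%E).
  apply: lp_modular_leM => // [|k].
    by rewrite invr_ge0 ltW //= invf_le1 //; lra.
  rewrite !normr_divp ?divr_gt0 //.
  rewrite ler_pdivrMr ?divr_gt0 //.
  apply: le_trans (dyadic_approx_err _ _ _) _ => //.
  have -> : (C + 1)^-1 * (`|x k| / l) * (eps / 2) =
            (eps / (2 * l * (C + 1))) * `|x k|.
    by field; rewrite !gt_eqF.
  rewrite ler_wpM2r // ler_pdivrMr // mulrAC ler_pdivlMr ?mulr_gt0 //.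
  by move: JE; rewrite ltr_pdivrMr //; lra.
rewrite -(fineK fin) -EFinM lee_fin mulrC ler_pdivrMr // mul1r -/C; lra.
Qed.
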